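(* Fix an integer $d\ge2$. There exist constants $c_d>0$ and $\bar\rho_d<2$ such that for every $m\in\mathbb N$, every $\alpha\in\mathcal S_d$ and every $r\ge 0$, $$\left| B(\alpha;2^rm,2^r(m+1)) - \frac{2^r}{N_d}\right| < c_d\,\bar\rho_d^{\,r}.$$
   Context: The Stern sequence $(s(n))_{n\ge0}$ is defined by $s(0)=0$, $s(1)=1$, $s(2n)=s(n)$, $s(2n+1)=s(n)+s(n+1)$. For an integer $d\ge2$, let $S_d(n)=(s(n)\bmod d,\ s(n+1)\bmod d)$, and let $\mathcal S_d=\{(i\bmod d, j\bmod d): \gcd(i,j,d)=1\}$; $N_d=|\mathcal S_d|$. For $\gamma\in\mathcal S_d$ and integers $U_1<U_2$, let $B(\gamma;U_1,U_2)=|\{m: U_1\le m<U_2,\ S_d(m)=\gamma\}|$. *)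

(* Defs.v *)
From mathcomp Require Import all_boot all_order all_algebra.
From mathcomp Require Import reals.

Set Implicit Arguments.
Unset Strict Implicit.
Unset Printing Implicit Defensive.

Import Order.TTheory GRing.Theory Num.Theory.

Local Open Scope ring_scope.

(* The recursion is on a fuel argument [k]; [k = n] is always enough, because
   n./2.+1 < n for odd n > 1.  The lemmas [stern0], [stern1], [stern_double]
   and [stern_doubleS] are the usual recursive characterization. *)
Fixpoint stern_rec (k n : nat) : nat :=
  if k is k'.+1 then
    if (n <= 1)%N then n
    else if odd n then (stern_rec k' n./2 + stern_rec k' n./2.+1)%N
    else stern_rec k' n./2
  else 0%N.

Definition stern (n : nat) : nat := stern_rec n n.

(* Residues mod d live in 'Z_d, which is Z/dZ only for d >= 2. *)
Definition stern_pair (d n : nat) : 'Z_d * 'Z_d :=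
  ((stern n)%:R, (stern n.+1)%:R).

(* The gcd is taken on the representatives in [0, d); lemma [mem_coprime_pairs]
   shows that this does not depend on the choice of integer representatives. *)
Definition coprime_pairs (d : nat) : {set 'Z_d * 'Z_d} :=
  [set g : 'Z_d * 'Z_d | gcdn (gcdn g.1 g.2) d == 1%N].

Definition stern_count (d : nat) (g : 'Z_d * 'Z_d) (U1 U2 : nat) : nat :=
  count (fun m => stern_pair d m == g) (index_iota U1 U2).

Arguments stern_count : clear implicits.

Lemma stern_rec_fuel (k l n : nat) :
  (n <= k)%N -> (n <= l)%N -> stern_rec k n = stern_rec l n.
Proof.
elim: k l n => [|k IHk] [|l] [|n] //= nk nl.
case: ifP => // /negbT; rewrite -ltnNge ltnS => n_gt0.
have hn : (uphalf n <= n)%N.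
  by rewrite uphalf_half -[leqRHS]odd_double_half leq_add2l -addnn leq_addr.
case: ifP => on; last by apply: IHk; apply: leq_trans hn _.
have hS : ((uphalf n).+1 <= n)%N.
  by rewrite uphalf_half (negbTE on) add0n ltn_half_double -addnn -addn1 leq_add2l.
by congr addn; apply: IHk; [exact: leq_trans hn _ | exact: leq_trans hn _
  | exact: leq_trans hS _ | exact: leq_trans hS _].
Qed.

Lemma stern0 : stern 0 = 0%N.
Proof. by []. Qed.

Lemma stern1 : stern 1 = 1%N.
Proof. by []. Qed.

Lemma stern_recS (k n : nat) : stern_rec k.+1 n =
  if (n <= 1)%N then n
  else if odd n then (stern_rec k n./2 + stern_rec k n./2.+1)%N
  else stern_rec k n./2.
Proof. by []. Qed.

Lemma stern_double (n : nat) : stern n.*2 = stern n.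
Proof.
case: n => [//|n]; rewrite /stern (@stern_rec_fuel _ n.+1.*2.+1) //.
rewrite stern_recS odd_double doubleK [(_ <= 1)%N]/=.
by apply: stern_rec_fuel => //; rewrite -addnn leq_addl.
Qed.

Lemma stern_doubleS (n : nat) : stern n.*2.+1 = (stern n + stern n.+1)%N.
Proof.
case: n => [//|n]; rewrite {1}/stern stern_recS.
have -> : n.+1.*2.+1./2 = n.+1 by exact: (half_bit_double n.+1 true).
have -> : odd n.+1.*2.+1 by rewrite oddS odd_double.
rewrite [(_ <= 1)%N]/=; congr addn; apply: stern_rec_fuel => //;
by rewrite doubleS ?ltnS -addnn ?leqW ?leq_addl.
Qed.

Lemma mem_coprime_pairs (d : nat) (i j : int) : (1 < d)%N ->
  (((i%:~R, j%:~R) : 'Z_d * 'Z_d) \in coprime_pairs d)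
  = (gcdz (gcdz i j) d == 1).
Proof.
move=> d_gt1.
have d0 : (d : int) != 0 by rewrite eqz_nat -lt0n ltnW.
have rep (k : int) : ((k%:~R : 'Z_d) : nat)%:Z = (k %% d)%Z.
  have E := gez0_abs (modz_ge0 k d0).
  have -> : k%:~R = `|(k %% d)%Z|%N%:R :> 'Z_d.
    rewrite {1}(divz_eq k d) intrD intrM -[d%:~R]pmulrn pchar_Zp //.
    by rewrite mulr0 add0r -{1}E.
  rewrite val_Zp_nat // modn_small // -ltz_nat E.
  by rewrite ltz_pmod // ltz_nat ltnW.
rewrite inE /= -eqz_nat.
have -> : (gcdn (gcdn (i%:~R : 'Z_d) (j%:~R : 'Z_d)) d)%:Z =
   gcdz (gcdz (i %% d)%Z (j %% d)%Z) d by rewrite -!rep.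
by rewrite -gcdzA gcdz_modl gcdzCA gcdz_modl gcdzA [gcdz j i]gcdzC.
Qed.

(* Main.v *)
(** The residue pairs over [2^r m, 2^r (m+1)) are the leaves of a binary tree of
    depth [r] rooted at [S_d(m)], with branching [(a,b) -> (a,a+b), (a+b,b)].
    Both branches permute the set of [N_d] admissible pairs, so the number
    [f_r(x)] of leaves equal to [alpha] below the root [x] has mean [2^r / N_d]
    over [x].  The Euclidean algorithm leads every admissible pair to [(0,1)],
    a fixed point of one branch; hence at some depth [L] every tree has a leaf
    [(0,1)].  Cancelling that common leaf, the oscillation of [f_(r+L)] is at
    most [2^L - 1] times that of [f_r]. *)

Require Import Defs.
From mathcomp Require Import all_boot all_order all_algebra.
From mathcomp Require Import reals.
From mathcomp Require Import zify lra.

Set Implicit Arguments.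
Unset Strict Implicit.
Unset Printing Implicit Defensive.

Import Order.TTheory GRing.Theory Num.Theory.

Local Open Scope ring_scope.

(** * Leaf lists of binary trees *)

Fixpoint leaves {T : Type} (A B : T -> T) (n : nat) (x : T) : seq T :=
  if n is n'.+1 then leaves A B n' (A x) ++ leaves A B n' (B x) else [:: x].

Lemma size_leaves (T : Type) (A B : T -> T) n x :
  size (leaves A B n x) = (2 ^ n)%N.
Proof.
elim: n x => [|n IHn] x //=.
by rewrite size_cat !IHn addnn expnS mul2n.
Qed.

Lemma leaves_add (T : Type) (A B : T -> T) l n x :
  leaves A B (l + n) x = flatten [seq leaves A B n y | y <- leaves A B l x].
Proof.
elim: l x => [|l IHl] x /=; first by rewrite cats0.
by rewrite !IHl map_cat flatten_cat.
Qed.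

(** Entries are paired in list order; any pairing would do, since [D] bounds every difference on
    [P]. *)
Lemma ler_dist_sum_seq (R : realType) (T : eqType) (P : pred T) (f : T -> R)
    (D : R) (s t : seq T) :
  {in P &, forall x y, `|f x - f y| <= D} ->
  all P s -> all P t -> size s = size t ->
  `|\sum_(x <- s) f x - \sum_(x <- t) f x| <= D *+ size s.
Proof.
move=> fD; elim: s t => [|x s IHs] [|y t] //=.
  by rewrite !big_nil subrr normr0 mulr0n.
move=> /andP[Px Ps] /andP[Py Pt] [st]; rewrite !big_cons opprD addrACA mulrS.
by apply: le_trans (ler_normD _ _) (lerD (fD _ _ Px Py) (IHs _ Ps Pt st)).
Qed.

(** * Mixing for two permutations and a fixed point reachable from all of [S] *)

Section Mixing.
Context {T : finType} {S : {set T}} {A B : T -> T} {z : T}.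
Hypotheses (injA : injective A) (injB : injective B).
Hypotheses (memA : forall x, (A x \in S) = (x \in S)).
Hypotheses (memB : forall x, (B x \in S) = (x \in S)).
Hypotheses (Az : A z = z).
Hypothesis reach : forall x, x \in S -> exists n, z \in leaves A B n x.

Lemma all_leaves n x : x \in S -> all [in S] (leaves A B n x).
Proof.
elim: n x => [|n IHn] x xS /=; first by rewrite xS.
by rewrite all_cat !IHn ?memA ?memB.
Qed.

(** A leaf [z] has [A z = z] as a child, so once reached it persists at all greater depths. *)
Lemma mem_leavesS n x : z \in leaves A B n x -> z \in leaves A B n.+1 x.
Proof.
elim: n x => [|n IHn] x; first by rewrite !inE => /eqP <-; rewrite Az eqxx.
rewrite [leaves A B n.+1 x]/= mem_cat => /orP[] /IHn zx.
  by rewrite [leaves A B n.+2 x]/= mem_cat zx.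
by rewrite [leaves A B n.+2 x]/= mem_cat zx orbT.
Qed.

Lemma mem_leaves_le m n x : (m <= n)%N ->
  z \in leaves A B m x -> z \in leaves A B n x.
Proof.
move=> /subnK <- zx; elim: (n - m)%N => [//|k]; rewrite addSn.
exact: mem_leavesS.
Qed.

(** [S] is finite, so the maximum of the individual depths works. The form [l.+1] keeps the depth
    positive, as the later descent by blocks of that many levels requires. *)
Lemma uniform_reach : exists l, forall x, x \in S -> z \in leaves A B l.+1 x.
Proof.
suff [l lP] : exists l, forall x, x \in enum S -> z \in leaves A B l x.
  by exists l => x xS; apply: mem_leavesS; apply: lP; rewrite mem_enum.
have : {subset enum S <= S} by move=> x; rewrite mem_enum.
elim: (enum S) => [|x s IHs] sS; first by exists 0%N.
have [|l lP] := IHs; first by move=> y ys; apply: sS; rewrite inE ys orbT.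
have [n nP] := reach (sS x (mem_head x s)).
exists (maxn n l) => y; rewrite inE => /predU1P[->|ys].
  exact: mem_leaves_le (leq_maxl _ _) nP.
exact: mem_leaves_le (leq_maxr _ _) (lP _ ys).
Qed.

Variable R : realType.
Implicit Types (D : R) (w : T).

Lemma count_leaves_add w l n x :
  (count_mem w (leaves A B (l + n) x))%:R =
  \sum_(y <- leaves A B l x) (count_mem w (leaves A B n y))%:R :> R.
Proof. by rewrite leaves_add count_flatten -map_comp sumnE big_map natr_sum. Qed.

(** [A] and [B] each permute [S], so the total over [S] doubles with each level. *)
Lemma sum_count_leaves w n : w \in S ->
  \sum_(x in S) (count_mem w (leaves A B n x))%:R = 2 ^+ n :> R.
Proof.
move=> wS; elim: n => [|n IHn].
  rewrite (bigD1 w) //= eqxx big1 ?addr0 // => x /andP[_ /negPf xw].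
  by rewrite xw.
under eq_bigr => x _ do rewrite /= count_cat natrD.
rewrite big_split /= exprS mulr_natl -IHn mulr2n; congr (_ + _).
  by rewrite [RHS](reindex_inj injA); apply: eq_bigl => x; rewrite memA.
by rewrite [RHS](reindex_inj injB); apply: eq_bigl => x; rewrite memB.
Qed.

Lemma osc_count_leaves w l n D :
  {in S, forall x, z \in leaves A B l x} ->
  {in S &, forall x y, `|(count_mem w (leaves A B n x))%:R
                         - (count_mem w (leaves A B n y))%:R| <= D} ->
  {in S &, forall x y, `|(count_mem w (leaves A B (l + n) x))%:R
                         - (count_mem w (leaves A B (l + n) y))%:R|
                       <= (2 ^+ l - 1) * D}.
Proof.
move=> lP nD x y xS yS; rewrite !count_leaves_add.
(* The subtree below one copy of [z] contributes equally to both sums and cancels; [2 ^ l - 1] pairs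
   of subtrees remain. *)
rewrite !(perm_big _ (perm_to_rem (lP _ _))) // !big_cons opprD addrACA subrr add0r.
have allrem u : u \in S -> all [in S] (rem z (leaves A B l u)).
  by move=> uS; apply/allP => v /mem_rem; apply/allP/all_leaves.
have size_rem u : u \in S -> size (rem z (leaves A B l u)) = (2 ^ l - 1)%N.
  by move=> uS; rewrite size_rem ?lP // size_leaves subn1.
apply: le_trans (ler_dist_sum_seq nD (allrem _ xS) (allrem _ yS) _) _.
  by rewrite !size_rem.
by rewrite size_rem // -[leLHS]mulr_natl natrB ?expn_gt0 // natrX.
Qed.

Lemma dist_count_leaves_trivial w n x y :
  `|(count_mem w (leaves A B n x))%:R - (count_mem w (leaves A B n y))%:R|
  <= 2 ^+ n :> R.
Proof.
have le u : (count_mem w (leaves A B n u))%:R <= 2 ^+ n :> R.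
  by rewrite -natrX ler_nat -(size_leaves A B n u) count_size.
have := le x; have := le y; rewrite ler_norml.
set a := _%:R; set b := _%:R => bM aM.
by have := ler0n R (count_mem w (leaves A B n x));
  have := ler0n R (count_mem w (leaves A B n y)); lra.
Qed.

Lemma exists_rate l : exists rho : R,
  [/\ 1 <= rho, rho < 2 & 2 ^+ l.+1 - 1 <= rho ^+ l.+1].
Proof.
(* Bernoulli's inequality for [rho = 2 (1 - e)] with [e (l+1) 2^(l+1) = 1]. *)
pose N : R := l.+1%:R * 2 ^+ l.+1.
have l1 : 1 <= l.+1%:R :> R by rewrite ler1n.
have p1 : 1 <= 2 ^+ l :> R by rewrite exprn_ege1 // ler1n.
have N2 : 2 <= N by rewrite /N exprS; nra.
have N0 : 0 < N by lra.
have e0 : 0 < N^-1 by rewrite invr_gt0.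
have e2 : N^-1 <= 1 / 2 by rewrite mul1r lef_pV2 ?posrE //; lra.
exists (2 * (1 - N^-1)); split; [lra | lra |].
have bern k : 1 - k%:R * N^-1 <= (1 - N^-1) ^+ k.
  elim: k => [|k IHk]; first by rewrite mul0r subr0.
  have k0 : 0 <= k%:R :> R by [].
  rewrite exprS -natr1; nra.
rewrite exprMn; apply: le_trans (ler_wpM2l _ (bern _)); last first.
  by rewrite exprn_ge0.
rewrite mulrBr mulr1 lerD2l lerN2 mulrA [2 ^+ _ * _]mulrC.
by rewrite divff // gt_eqF.
Qed.

Theorem leaves_equidistributed : exists c rho : R, 0 < c /\ rho < 2 /\
  forall w n, w \in S -> {in S, forall x,
    `|(count_mem w (leaves A B n x))%:R - 2 ^+ n / #|S|%:R| < c * rho ^+ n}.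
Proof.
have [l lP] := uniform_reach; have [rho [rho1 rho2 rhol]] := exists_rate l.
have rho0 : 0 < rho by lra.
have p0 : 0 < 2 ^+ l.+1 :> R by rewrite exprn_gt0.
(* [2 ^+ l.+1] absorbs the depths [n <= l], where only the trivial bound is available; the extra 1
   makes the inequality strict. *)
exists (2 ^+ l.+1 + 1), rho; split; first by lra.
split=> // w n wS x xS.
have osc : {in S &, forall x y, `|(count_mem w (leaves A B n x))%:R
    - (count_mem w (leaves A B n y))%:R| <= 2 ^+ l.+1 * rho ^+ n}.
  (* Each block of [l.+1] levels multiplies the bound by at most [2 ^+ l.+1 - 1 <= rho ^+ l.+1]. *)
  elim/ltn_ind: n => n IHn; have [ln|nl] := ltnP l n; last first.
    move=> u v _ _; apply: le_trans (dist_count_leaves_trivial _ _ _ _) _.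
    rewrite -[leLHS]mulr1 ler_pM ?exprn_ge0 ?exprn_ege1 //.
    by rewrite ler_weXn2l ?ler1n // ltnW.
  move=> u v uS vS; rewrite -(subnKC ln).
  apply: le_trans (osc_count_leaves lP (IHn _ _) uS vS) _; first lia.
  by rewrite exprD mulrCA (ler_wpM2l (ltW p0)) // ler_wpM2r // exprn_ge0 // ltW.
have S0 : 0 < #|S|%:R :> R by rewrite ltr0n (cardD1 x) xS.
have r0 : 0 < rho ^+ n by rewrite exprn_gt0.
apply: (@le_lt_trans _ _ (2 ^+ l.+1 * rho ^+ n)); last by rewrite ltr_pM2r //; lra.
(* After multiplication by the size of [S], the mean becomes the sum of the counts over all roots
   [y], and each term is an oscillation. *)
rewrite -(ler_pM2r S0) -[X in _ * X <= _](gtr0_norm S0) -normrM mulrBl.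
rewrite divfK ?gt_eqF // -(sum_count_leaves n wS) !mulr_natr -!sumr_const -sumrB.
by apply: le_trans (ler_norm_sum _ _ _) (ler_sum _ _) => y yS; apply: osc.
Qed.

End Mixing.

(** * The branching of Stern pairs modulo [d] *)

Section SternBranching.
Variable d : nat.

Definition stern_left (g : 'Z_d * 'Z_d) : 'Z_d * 'Z_d := (g.1, g.1 + g.2).
Definition stern_right (g : 'Z_d * 'Z_d) : 'Z_d * 'Z_d := (g.1 + g.2, g.2).

Lemma stern_left_inj : injective stern_left.
Proof. by move=> [a b] [a' b'] /pair_equal_spec[/= -> /addrI->]. Qed.

Lemma stern_right_inj : injective stern_right.
Proof. by move=> [a b] [a' b'] /pair_equal_spec[/= e eb]; move: e; rewrite eb => /addIr->. Qed.

Lemma stern_pair_double m : stern_pair d m.*2 = stern_left (stern_pair d m).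
Proof. by rewrite /stern_pair stern_double stern_doubleS natrD. Qed.

Lemma stern_pair_doubleS m : stern_pair d m.*2.+1 = stern_right (stern_pair d m).
Proof. by rewrite /stern_pair -doubleS stern_double stern_doubleS natrD. Qed.

Lemma map_stern_pair r m :
  [seq stern_pair d k | k <- index_iota (2 ^ r * m) (2 ^ r * m.+1)] =
  leaves stern_left stern_right r (stern_pair d m).
Proof.
elim: r m => [|r IHr] m.
  by rewrite expn0 !mul1n /index_iota subSnn.
rewrite /= -stern_pair_double -stern_pair_doubleS -!IHr -map_cat; congr map.
have E k : (2 ^ r.+1 * k = 2 ^ r * k.*2)%N by rewrite expnSr -mulnA mul2n.
rewrite !E doubleS /index_iota.
(* The intervals of the children [m.*2] and [m.*2.+1] are adjacent: the second start is rewritten as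
   the first start plus a length, so that [iotaD] glues them. *)
rewrite -[X in _ ++ iota X _](@subnKC (2 ^ r * m.*2)) ?leq_mul //.
rewrite -iotaD; congr iota; lia.
Qed.

Hypothesis hd : (2 <= d)%N.

Lemma Zd_int (a : 'Z_d) : a = (a : nat)%:Z%:~R.
Proof. by rewrite -pmulrn natr_Zp. Qed.

(** The sum may wrap around modulo [d]; lifting to integers reduces the claim to invariance of the
    gcd under addition. *)
Lemma mem_stern_left g :
  (stern_left g \in coprime_pairs d) = (g \in coprime_pairs d).
Proof.
case: g => a b; rewrite /stern_left /= (Zd_int a) (Zd_int b) -intrD.
by rewrite !mem_coprime_pairs // gcdzDl.
Qed.

Lemma mem_stern_right g :
  (stern_right g \in coprime_pairs d) = (g \in coprime_pairs d).
Proof.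
case: g => a b; rewrite /stern_right /= (Zd_int a) (Zd_int b) -intrD.
by rewrite !mem_coprime_pairs // ![gcdz _ b]gcdzC gcdzDr.
Qed.

Lemma mem_coprime_pairs01 : (0, 1) \in coprime_pairs d.
Proof. by apply: etrans (mem_coprime_pairs 0 1 hd) _; rewrite gcdz1 /gcdz gcd1n. Qed.

Lemma stern_pair_coprime m : stern_pair d m \in coprime_pairs d.
Proof.
elim/ltn_ind: m => -[|m] IHm; first exact: mem_coprime_pairs01.
rewrite -(odd_double_half m.+1); have := IHm m.+1./2.
case: (odd _) => /= IH.
  by rewrite stern_pair_doubleS mem_stern_right IH // uphalf_half; lia.
by rewrite stern_pair_double mem_stern_left IH // uphalf_half; lia.
Qed.

Let reaches (g : 'Z_d * 'Z_d) :=
  exists n, (0, 1) \in leaves stern_left stern_right n g.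

Lemma reaches_left g : reaches (stern_left g) -> reaches g.
Proof. by case=> n nP; exists n.+1; rewrite /= mem_cat nP. Qed.

Lemma reaches_right g : reaches (stern_right g) -> reaches g.
Proof. by case=> n nP; exists n.+1; rewrite /= mem_cat nP orbT. Qed.

(** A residue [k] is a natural number of right branches. Negative multipliers are thus allowed,
    which turns the additive branching into Euclidean subtraction. *)
Lemma reaches_addl (k a b : 'Z_d) : reaches (a + k * b, b) -> reaches (a, b).
Proof.
rewrite -[k]natr_Zp mulr_natl; elim: (k : nat) a => [|n IHn] a.
  by rewrite mulr0n addr0.
rewrite mulrS addrA => /IHn; exact: (@reaches_right (a, b)).
Qed.

Lemma reaches_addr (k a b : 'Z_d) : reaches (a, b + k * a) -> reaches (a, b).
Proof.
rewrite -[k]natr_Zp mulr_natl; elim: (k : nat) b => [|n IHn] b.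
  by rewrite mulr0n addr0.
rewrite mulrS addrA [b + a]addrC => /IHn; exact: (@reaches_left (a, b)).
Qed.

Lemma reaches_1r (a : 'Z_d) : reaches (a, 1).
Proof.
apply: (@reaches_addl (- a)); rewrite mulr1 subrr.
by exists 0%N; rewrite inE.
Qed.

(** Subtractive Euclidean algorithm on representatives, by induction on [a + b]. When one entry
    vanishes, the other is a unit modulo [d]. *)
Lemma reaches_coprime (a b : nat) : coprime d (gcdn a b) ->
  reaches (a%:R, b%:R).
Proof.
have [n] := ubnP (a + b); elim: n a b => [//|n IHn] a b abn cop.
have [a0|a0] := posnP a.
  move: cop; rewrite a0 gcd0n => cop.
  have ub : (b%:R : 'Z_d) \is a GRing.unit by rewrite unitZpE.
  (* The path is [(0, b)], [(1, b)], [(1, 1)]. *)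
  apply: (@reaches_addl b%:R^-1); rewrite add0r mulVr //.
  apply: (@reaches_addr (1 - b%:R)); rewrite mulr1 addrC subrK.
  exact: reaches_1r.
have [b0|b0] := posnP b.
  move: cop; rewrite b0 gcdn0 => cop.
  have ua : (a%:R : 'Z_d) \is a GRing.unit by rewrite unitZpE.
  apply: (@reaches_addr a%:R^-1); rewrite add0r mulVr //.
  exact: reaches_1r.
have [ab|/ltnW ba] := leqP a b.
  apply: (@reaches_addr (-1)); rewrite mulN1r -natrB //.
  apply: IHn; first lia.
  by rewrite -gcdnDr subnK.
apply: (@reaches_addl (-1)); rewrite mulN1r -natrB //.
apply: IHn; first lia.
by rewrite gcdnC -gcdnDr subnK // gcdnC.
Qed.

Lemma reaches_coprime_pairs g : g \in coprime_pairs d -> reaches g.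
Proof.
case: g => a b; rewrite inE /= -/(coprime _ _) coprime_sym => /reaches_coprime.
by rewrite !natr_Zp.
Qed.

End SternBranching.

Theorem theorem4p6 (R : realType) (d : nat) (hd : (2 <= d)%N) :
  exists c rho : R, 0 < c /\ rho < 2 /\
    forall (m : nat) (alpha : 'Z_d * 'Z_d), alpha \in coprime_pairs d ->
    forall r : nat,
      `| (stern_count d alpha (2 ^ r * m)%N (2 ^ r * m.+1)%N)%:R
         - 2 ^+ r / #|coprime_pairs d|%:R | < c * rho ^+ r.
Proof.
have fixed01 : @stern_left d (0, 1) = (0, 1) by rewrite /stern_left /= add0r.
have [c [rho [c0 [rho2 crho]]]] := leaves_equidistributed
  (@stern_left_inj d) (@stern_right_inj d) (mem_stern_left hd)
  (mem_stern_right hd) fixed01 (reaches_coprime_pairs hd) R.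
(* The constants are uniform in [m], which enters only through the root [stern_pair d m]. *)
exists c, rho; split=> //; split=> // m alpha alphaS r.
have -> : stern_count d alpha (2 ^ r * m) (2 ^ r * m.+1) =
    count_mem alpha (leaves (@stern_left d) (@stern_right d) r (stern_pair d m)).
  by rewrite -map_stern_pair; apply/esym/count_map.
exact: crho (stern_pair_coprime hd m).
Qed.
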